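(* Let $\mathscr{A}=(a_{ijklpq})\in\mathbb{T}_{6,3}$ be a paired symmetric tensor. Then the polynomial $\mathscr{A}x^2y^2z^2$ is positive definite if and only if one of the following holds: (i) $\mathscr{A}_{11}y^2z^2>0$, $(\mathscr{A}_{11}y^2z^2)(\mathscr{A}_{22}y^2z^2)-(\mathscr{A}_{12}y^2z^2)(\mathscr{A}_{21}y^2z^2)>0$ and $\det(A(y,z))>0$ for all $y,z\in\mathbb{R}^3\setminus\{0\}$; (ii) $\mathscr{B}_{11}x^2z^2>0$, $(\mathscr{B}_{11}x^2z^2)(\mathscr{B}_{22}x^2z^2)-(\mathscr{B}_{12}x^2z^2)(\mathscr{B}_{21}x^2z^2)>0$ and $\det(B(x,z))>0$ for all $x,z\in\mathbb{R}^3\setminus\{0\}$; (iii) $\mathscr{C}_{11}x^2y^2>0$, $(\mathscr{C}_{11}x^2y^2)(\mathscr{C}_{22}x^2y^2)-(\mathscr{C}_{12}x^2y^2)(\mathscr{C}_{21}x^2y^2)>0$ and $\det(C(x,y))>0$ for all $x,y\in\mathbb{R}^3\setminus\{0\}$. Furthermore, if $\mathscr{A}$ is an elasticity tensor, then conditions (i), (ii) and (iii) are the same.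
   Context: $\mathbb{T}_{6,3}$ is the set of real tensors $\mathscr{A}=(a_{ijklpq})$ with $i,j,k,l,p,q\in\{1,2,3\}$. $\mathscr{A}$ is paired symmetric if $a_{ijklpq}=a_{jiklpq}=a_{ijlkpq}=a_{ijklqp}$ for all indices; a paired symmetric tensor is an elasticity tensor if moreover $a_{ijklpq}=a_{klijpq}=a_{ijpqkl}$ for all indices. For $x,y,z\in\mathbb{R}^3$, $\mathscr{A}x^2y^2z^2:=\sum_{i,j,k,l,p,q=1}^3a_{ijklpq}x_ix_jy_ky_lz_pz_q$; this polynomial is positive definite if $\mathscr{A}x^2y^2z^2>0$ for all $x,y,z\in\mathbb{R}^3\setminus\{0\}$. For a fourth order tensor $\mathscr{D}=(d_{abcd})$ with indices in $\{1,2,3\}$ and $u,v\in\mathbb{R}^3$, $\mathscr{D}u^2v^2:=\sum d_{abcd}u_au_bv_cv_d$. The fourth order sub-tensors of $\mathscr{A}$ are $\mathscr{A}_{ij}:=(a_{ijklpq})_{klpq}$ ($i,j$ fixed), $\mathscr{B}_{kl}:=(a_{ijklpq})_{ijpq}$ ($k,l$ fixed), $\mathscr{C}_{pq}:=(a_{ijklpq})_{ijkl}$ ($p,q$ fixed). $A(y,z)$, $B(x,z)$, $C(x,y)\in\mathbb{R}^{3\times3}$ are the matrices whose $(s,t)$ entries are $\mathscr{A}_{st}y^2z^2$, $\mathscr{B}_{st}x^2z^2$, $\mathscr{C}_{st}x^2y^2$ respectively. *)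

(* Defs.v *)
From mathcomp Require Import all_boot all_order all_algebra.
From mathcomp Require Import reals.

Set Implicit Arguments.
Unset Strict Implicit.
Unset Printing Implicit Defensive.

Import Order.TTheory GRing.Theory Num.Theory.
Local Open Scope ring_scope.

(* The indices 1, 2, 3 are the elements 0, 1, 2 of 'I_3; in particular the
   entry written _11 is at (0, 0) and the entry written _22 is at (1, 1). *)
Definition tensor4 (R : realType) : Type :=
  'I_3 -> 'I_3 -> 'I_3 -> 'I_3 -> R.

Definition tensor6 (R : realType) : Type :=
  'I_3 -> 'I_3 -> 'I_3 -> 'I_3 -> 'I_3 -> 'I_3 -> R.

Definition paired_symmetric (R : realType) (a : tensor6 R) : Prop :=
  forall i j k l p q : 'I_3,
    [/\ a i j k l p q = a j i k l p q,
        a i j k l p q = a i j l k p q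
      & a i j k l p q = a i j k l q p].

Definition elasticity_tensor (R : realType) (a : tensor6 R) : Prop :=
  paired_symmetric a /\
  forall i j k l p q : 'I_3,
    a i j k l p q = a k l i j p q /\ a i j k l p q = a i j p q k l.

Definition form4 (R : realType) (d : tensor4 R) (u v : 'rV[R]_3) : R :=
  \sum_(i < 3) \sum_(j < 3) \sum_(k < 3) \sum_(l < 3)
    d i j k l * u 0 i * u 0 j * v 0 k * v 0 l.

Definition form6 (R : realType) (a : tensor6 R) (x y z : 'rV[R]_3) : R :=
  \sum_(i < 3) \sum_(j < 3) \sum_(k < 3) \sum_(l < 3)
    \sum_(p < 3) \sum_(q < 3)
      a i j k l p q * x 0 i * x 0 j * y 0 k * y 0 l * z 0 p * z 0 q.

Definition positive_definite6 (R : realType) (a : tensor6 R) : Prop :=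
  forall x y z : 'rV[R]_3,
    x != 0 -> y != 0 -> z != 0 -> 0 < form6 a x y z.

Definition subA (R : realType) (a : tensor6 R) (i j : 'I_3) : tensor4 R :=
  fun k l p q => a i j k l p q.

Definition subB (R : realType) (a : tensor6 R) (k l : 'I_3) : tensor4 R :=
  fun i j p q => a i j k l p q.

Definition subC (R : realType) (a : tensor6 R) (p q : 'I_3) : tensor4 R :=
  fun i j k l => a i j k l p q.

(* For D = subA a, subB a, subC a this is A(u,v), B(u,v), C(u,v). *)
Definition form_mx (R : realType) (D : 'I_3 -> 'I_3 -> tensor4 R)
    (u v : 'rV[R]_3) : 'M[R]_3 :=
  \matrix_(s < 3, t < 3) form4 (D s t) u v.

Definition minors_positive (R : realType) (D : 'I_3 -> 'I_3 -> tensor4 R) :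
    Prop :=
  forall u v : 'rV[R]_3, u != 0 -> v != 0 ->
    [/\ 0 < form4 (D 0 0) u v,
        0 < form4 (D 0 0) u v * form4 (D 1 1) u v
            - form4 (D 0 1) u v * form4 (D 1 0) u v
      & 0 < \det (form_mx D u v)].

(* Main.v *)
(** Fixing two of the three vectors turns the sextic form into a quadratic form
    in the third one, with symmetric matrix A(y,z), B(x,z) or C(x,y); apply
    Sylvester's criterion to it.  Writing a, m, D for the leading principal
    minors of a symmetric 3x3 matrix with quadratic form Q, completing squares
    gives a m Q = m L1^2 + L2^2 + a D x3^2 with L1, L2 linear and L1, L2, x3
    triangular.  Conversely a, a m and m D are the values of Q at three explicit
    nonzero vectors. *)
Require Import Defs.
From mathcomp Require Import all_boot all_order all_algebra.
From mathcomp Require Import reals ring.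

Set Implicit Arguments.
Unset Strict Implicit.
Unset Printing Implicit Defensive.

Import Order.TTheory GRing.Theory Num.Theory.
Local Open Scope ring_scope.

Lemma sum_ord3 (V : nmodType) (F : 'I_3 -> V) :
  \sum_(i < 3) F i = F 0 + F 1 + F 2.
Proof.
rewrite !big_ord_recr big_ord0 /= add0r.
(* The ordinals produced by the recursion agree with [0], [1], [2] only in value. *)
by congr (F _ + F _ + F _); apply: val_inj.
Qed.

Lemma det_mx33 (R : comPzRingType) (M : 'M[R]_3) :
  \det M = M 0 0 * (M 1 1 * M 2 2 - M 1 2 * M 2 1)
         - M 0 1 * (M 1 0 * M 2 2 - M 1 2 * M 2 0)
         + M 0 2 * (M 1 0 * M 2 1 - M 1 1 * M 2 0).
Proof.
have det2 (N : 'M[R]_2) : \det N = N 0 0 * N 1 1 - N 0 1 * N 1 0.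
  rewrite (expand_det_row _ 0) !big_ord_recl big_ord0 /cofactor !det_mx11 !mxE.
  rewrite /= addr0 expr0 expr1 mul1r mulN1r mulrN.
  by congr (_ * N _ _ - N _ _ * N _ _); apply: val_inj.
rewrite (expand_det_row _ 0) sum_ord3 /cofactor !det2 !mxE /=.
rewrite expr0 expr1 sqrrN expr1n !mul1r mulN1r mulrN.
by congr (_ * (M _ _ * M _ _ - M _ _ * M _ _)
  - _ * (M _ _ * M _ _ - M _ _ * M _ _)
  + _ * (M _ _ * M _ _ - M _ _ * M _ _)); apply: val_inj.
Qed.

Definition qform (R : pzSemiRingType) (M : 'M[R]_3) (x : 'rV[R]_3) : R :=
  \sum_(s < 3) \sum_(t < 3) M s t * x 0 s * x 0 t.

Lemma rV3_eq0 (R : nmodType) (x : 'rV[R]_3) :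
  (x == 0) = [&& x 0 0 == 0, x 0 1 == 0 & x 0 2 == 0].
Proof.
apply/eqP/and3P => [-> | [/eqP x0 /eqP x1 /eqP x2]]; first by rewrite !mxE.
apply/rowP => -[[|[|[|//]]] lti]; rewrite mxE.
- by rewrite -[RHS]x0; congr (x _ _); apply: val_inj.
- by rewrite -[RHS]x1; congr (x _ _); apply: val_inj.
- by rewrite -[RHS]x2; congr (x _ _); apply: val_inj.
Qed.

Lemma sylvester3 (R : realFieldType) (M : 'M[R]_3) : M^T = M ->
  (forall x, x != 0 -> 0 < qform M x) <->
  [/\ 0 < M 0 0, 0 < M 0 0 * M 1 1 - M 0 1 * M 1 0 & 0 < \det M].
Proof.
move=> symM; have sym i j : M i j = M j i by rewrite -{1}symM mxE.
have qE x : qform M x =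
    M 0 0 * x 0 0 ^+ 2 + M 1 1 * x 0 1 ^+ 2 + M 2 2 * x 0 2 ^+ 2
    + 2 * (M 0 1 * x 0 0 * x 0 1 + M 0 2 * x 0 0 * x 0 2 + M 1 2 * x 0 1 * x 0 2).
  by rewrite /qform !sum_ord3 (sym 1 0) (sym 2 0) (sym 2 1); ring.
have detE := det_mx33 M.
rewrite (sym 1 0) (sym 2 0) (sym 2 1) in detE *.
(* The six independent entries become variables, so that what follows rests on polynomial identities
   in them. *)
move: (\det M) (M 0 0) (M 0 1) (M 0 2) (M 1 1) (M 1 2) (M 2 2) detE qE.
move=> D a b c d e f DE qE.
pose m := a * d - b * b; pose n := a * e - b * c.
pose vec (x0 x1 x2 : R) : 'rV[R]_3 :=
  \row_(i < 3) if i == 0 then x0 else if i == 1 then x1 else x2.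
have qvec x0 x1 x2 : qform M (vec x0 x1 x2) = a * x0 ^+ 2 + d * x1 ^+ 2
    + f * x2 ^+ 2 + 2 * (b * x0 * x1 + c * x0 * x2 + e * x1 * x2).
  by rewrite qE !mxE.
have vec0 x0 x1 x2 : (vec x0 x1 x2 == 0) = [&& x0 == 0, x1 == 0 & x2 == 0].
  by rewrite rV3_eq0 !mxE.
split=> [posq | [a_gt0 m_gt0 D_gt0] x].
  have a_gt0 : 0 < a.
    have := posq (vec 1 0 0); rewrite vec0 oner_eq0 => /(_ isT).
    by rewrite qvec !(expr0n, expr1n, mulr0, mulr1, addr0).
  have m_gt0 : 0 < m.
    (* This vector is orthogonal to the first row up to its last coordinate, which is 0; only the
       term in [m] survives. *)
    have := posq (vec (- b) a 0); rewrite vec0 (gt_eqF a_gt0) andbF => /(_ isT).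
    rewrite qvec (_ : _ + _ = a * m); last by rewrite /m; ring.
    by rewrite pmulr_rgt0.
  split=> //.
  (* The cofactors of the last row: the matrix sends this vector to [(0, 0, D)], whence the value
     [m * D]. *)
  have := posq (vec (b * e - c * d) (- n) m).
  rewrite vec0 (gt_eqF m_gt0) !andbF => /(_ isT).
  rewrite qvec (_ : _ + _ = m * D); last by rewrite DE /m /n; ring.
  by rewrite pmulr_rgt0.
rewrite rV3_eq0 qE; set x0 := x 0 0; set x1 := x 0 1; set x2 := x 0 2 => nz.
have am_gt0 : 0 < a * m by rewrite mulr_gt0.
rewrite -(pmulr_rgt0 _ am_gt0).
(* The coefficient of [x2 ^+ 2] left after both completions is [m * (a * f - c ^+ 2) - n ^+ 2],
   which equals [a * D] by the Desnanot-Jacobi identity. *)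
rewrite (_ : a * m * _ = m * (a * x0 + b * x1 + c * x2) ^+ 2
    + (m * x1 + n * x2) ^+ 2 + a * D * x2 ^+ 2); last first.
  by rewrite DE /m /n; ring.
have aD_gt0 : 0 < a * D by rewrite mulr_gt0.
have mL_ge0 y : 0 <= m * y ^+ 2 by rewrite mulr_ge0 ?sqr_ge0 // ltW.
(* Since the linear forms are triangular, the last nonzero coordinate of [x] picks out a square that
   is strictly positive. *)
have [x2_0 | x2_neq0] := eqVneq x2 0; last first.
  by rewrite ltr_wpDl ?addr_ge0 ?sqr_ge0 // mulr_gt0 // exprn_even_gt0.
rewrite x2_0 expr0n !mulr0 !addr0.
have [x1_0 | x1_neq0] := eqVneq x1 0; last first.
  by rewrite ltr_wpDl // exprn_even_gt0 //= mulf_neq0 // gt_eqF.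
rewrite x1_0 !mulr0 addr0 expr0n addr0 mulr_gt0 // exprn_even_gt0 //=.
move: nz; rewrite x1_0 x2_0 eqxx !andbT => x0_neq0.
by rewrite mulf_neq0 // gt_eqF.
Qed.

Lemma form6_swap12 (R : realType) (a : tensor6 R) (x y z : 'rV[R]_3) :
  form6 a x y z = form6 (fun k l i j p q => a i j k l p q) y x z.
Proof.
rewrite /form6.
(* Adjacent exchanges move [k] and [l] inward past [j], then past [i], to reach the order
   [k, l, i, j]. *)
under eq_bigr => i _.
  rewrite exchange_big; under eq_bigr => k _ do rewrite exchange_big.
  over.
rewrite exchange_big; apply: eq_bigr => k _.
rewrite exchange_big; apply: eq_bigr => l _.
do 4 (apply: eq_bigr => ? _); ring.
Qed.

Lemma form6_swap23 (R : realType) (a : tensor6 R) (x y z : 'rV[R]_3) :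
  form6 a x y z = form6 (fun i j p q k l => a i j k l p q) x z y.
Proof.
rewrite /form6; apply: eq_bigr => i _; apply: eq_bigr => j _.
under eq_bigr => k _.
  rewrite exchange_big; under eq_bigr => p _ do rewrite exchange_big.
  over.
rewrite exchange_big; apply: eq_bigr => p _.
rewrite exchange_big; apply: eq_bigr => q _.
do 2 (apply: eq_bigr => ? _); ring.
Qed.

Lemma form6_qform (R : realType) (a : tensor6 R) (x y z : 'rV[R]_3) :
  form6 a x y z = qform (form_mx (subA a) y z) x.
Proof.
apply: eq_bigr => i _; apply: eq_bigr => j _; rewrite mxE /form4 !mulr_suml.
do 3 (apply: eq_bigr => ? _; rewrite ?mulr_suml).
apply: eq_bigr => q _; rewrite /subA; ring.
Qed.

(** Symmetry in the first pair makes A(y,z) symmetric, so Sylvester's criterion applies for each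
    fixed [y], [z]. The permuted tensors below inherit exactly this hypothesis. *)
Lemma minors_positive_subA (R : realType) (a : tensor6 R) :
  (forall i j k l p q, a i j k l p q = a j i k l p q) ->
  positive_definite6 a <-> minors_positive (subA a).
Proof.
move=> sym_a.
have syl y z : (forall x, x != 0 -> 0 < form6 a x y z) <->
    [/\ 0 < form4 (subA a 0 0) y z,
        0 < form4 (subA a 0 0) y z * form4 (subA a 1 1) y z
            - form4 (subA a 0 1) y z * form4 (subA a 1 0) y z
      & 0 < \det (form_mx (subA a) y z)].
  have symM : (form_mx (subA a) y z)^T = form_mx (subA a) y z.
    apply/matrixP => s t; rewrite !mxE /form4 /subA.
    by do 4 (apply: eq_bigr => ? _); rewrite sym_a.
  have := sylvester3 symM; rewrite !mxE => <-.
  by split=> pos x /pos; rewrite form6_qform.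
split=> [pos y z y0 z0 | pos x y z x0 y0 z0].
  by apply/syl => x x0; apply: pos.
by apply: (proj2 (syl y z)) (pos y z y0 z0) x x0.
Qed.

Lemma minors_positive_subB (R : realType) (a : tensor6 R) :
  (forall i j k l p q, a i j k l p q = a i j l k p q) ->
  positive_definite6 a <-> minors_positive (subB a).
Proof.
move=> sym_a; pose a' : tensor6 R := fun k l i j p q => a i j k l p q.
(* Exchanging the first two index pairs turns B into A by mere conversion; positive definiteness is
   unaffected, as it quantifies over all three vectors. *)
rewrite -[minors_positive (subB a)]/(minors_positive (subA a')).
rewrite -minors_positive_subA; last by move=> *; apply: sym_a.
by split=> pos x y z x0 y0 z0; [rewrite -form6_swap12 | rewrite form6_swap12];
  apply: pos.
Qed.

Lemma minors_positive_subC (R : realType) (a : tensor6 R) :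
  (forall i j k l p q, a i j k l p q = a i j k l q p) ->
  positive_definite6 a <-> minors_positive (subC a).
Proof.
move=> sym_a; pose a' : tensor6 R := fun i j p q k l => a i j k l p q.
(* Likewise, exchanging the last two pairs turns C into B. *)
rewrite -[minors_positive (subC a)]/(minors_positive (subB a')).
rewrite -minors_positive_subB; last by move=> *; apply: sym_a.
by split=> pos x y z x0 y0 z0; [rewrite -form6_swap23 | rewrite form6_swap23];
  apply: pos.
Qed.

Theorem theorem4p5 (R : realType) (a : tensor6 R) (ha : paired_symmetric a) :
  (positive_definite6 a <->
     [\/ minors_positive (subA a),
         minors_positive (subB a)
       | minors_positive (subC a)]) /\
  (elasticity_tensor a ->
     [/\ minors_positive (subA a) <-> minors_positive (subB a),
         minors_positive (subB a) <-> minors_positive (subC a)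
       & forall u v : 'rV[R]_3,
           form_mx (subA a) u v = form_mx (subB a) u v /\
           form_mx (subB a) u v = form_mx (subC a) u v]).
Proof.
(* Each condition alone is equivalent to positive definiteness, which settles the disjunction and
   the equivalences among the three. *)
have iffA : positive_definite6 a <-> minors_positive (subA a).
  by apply: minors_positive_subA => i j k l p q; case: (ha i j k l p q).
have iffB : positive_definite6 a <-> minors_positive (subB a).
  by apply: minors_positive_subB => i j k l p q; case: (ha i j k l p q).
have iffC : positive_definite6 a <-> minors_positive (subC a).
  by apply: minors_positive_subC => i j k l p q; case: (ha i j k l p q).
split; first by split=> [/iffA | []]; [constructor 1 | move/iffA | move/iffB | move/iffC].
case=> _ el; split; [by rewrite -iffA | by rewrite -iffB | move=> u v].
(* Entrywise, A and B differ by an exchange of the first two index pairs, B and C by one of the last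
   two. *)
split; apply/matrixP => s t; rewrite !mxE /form4 /subA /subB /subC;
  do 4 (apply: eq_bigr => ? _).
- by rewrite (proj1 (el _ _ _ _ _ _)).
- by rewrite (proj2 (el _ _ _ _ _ _)).
Qed.
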